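(* For the unary pattern $x^k$, we have $\lambda_\simeq(x^k)=3$ if $k\in\{2,3\}$, and $\lambda_\simeq(x^k)=2$ if $k\ge 4$.
   Context: A pattern is a word over an alphabet of variables; $x^k$ denotes the pattern consisting of the variable $x$ repeated $k$ times. For words, $x\simeq x'$ iff $x'\in\{x,x^R\}$ ($x^R$ the reversal). A word $w$ encounters a pattern $p=p_1\cdots p_n$ up to $\simeq$ if it has a factor $X_1\cdots X_n$ with all $X_i$ nonempty and $X_i\simeq X_j$ whenever $p_i=p_j$; otherwise it avoids $p$ up to $\simeq$. The undirected avoidability index $\lambda_\simeq(p)$ is the least positive integer $k$ such that some infinite word over a $k$-letter alphabet avoids $p$ up to $\simeq$, or $\infty$ if no such $k$ exists. *)

(* Defs.v *)
From mathcomp Require Import all_boot.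
From mathcomp Require Import boolp.

Set Implicit Arguments.
Unset Strict Implicit.
Unset Printing Implicit Defensive.

Definition undirected_equiv (A : Type) (u v : seq A) : Prop :=
  v = u \/ v = rev u.

(* An infinite word over A is a function nat -> A. *)
Definition factor_of (A : Type) (u : seq A) (w : nat -> A) : Prop :=
  exists i : nat, u = mkseq (fun j => w (i + j)) (size u).

(* A pattern is a sequence of variables; Xs lists the blocks X_1, ..., X_n. *)
Definition encounters (V A : Type) (w : nat -> A) (p : seq V) : Prop :=
  exists Xs : seq (seq A),
    [/\ size Xs = size p,
        forall i, i < size p -> nth [::] Xs i <> [::],
        forall i j, i < size p -> j < size p -> onth p i = onth p j ->
          undirected_equiv (nth [::] Xs i) (nth [::] Xs j)
      & factor_of (flatten Xs) w].

Definition avoids (V A : Type) (w : nat -> A) (p : seq V) : Prop :=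
  ~ encounters w p.

Definition avoidable_over (V : Type) (p : seq V) (k : nat) : Prop :=
  0 < k /\ exists w : nat -> 'I_k, avoids w p.

(* None stands for infinity. *)
Definition undirected_index (V : Type) (p : seq V) : option nat :=
  match pselect (exists k, `[< avoidable_over p k >]) with
  | left avoidable => Some (ex_minn avoidable)
  | right _ => None
  end.

(* Main.v *)
Require Import Defs.
From mathcomp Require Import all_boot.
From mathcomp Require Import boolp zify.

Set Implicit Arguments.
Unset Strict Implicit.
Unset Printing Implicit Defensive.

(** A square-free word avoids [x^2] up to reversal, because [X X^R] contains
    the square of the last letter of [X]; the first differences of the
    Thue-Morse word are square-free over three letters.  Every binary word of
    length 10 contains an undirected cube.  For [k >= 4], replace the letters
    of the square-free ternary word by [0111], [0011], [0001].  The resulting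
    word has no palindrome of length 8, so an undirected fourth power with long
    blocks is a genuine one; as the factor [10] only occurs where two code
    words meet, its period is a multiple of 4, and it decodes to a square. *)

(** * Undirected powers as consecutive blocks of equal length *)

Definition block (A : Type) (w : nat -> A) (i n : nat) : seq A :=
  mkseq (fun j => w (i + j)) n.

(** Comparison with the first block suffices, as [undirected_equiv] is an equivalence relation. *)
Definition has_undirected_power (A : Type) (w : nat -> A) (k i p : nat) : Prop :=
  forall a, a < k -> undirected_equiv (block w i p) (block w (i + a * p) p).

Section Blocks.

Variable A : Type.
Implicit Types (u v X : seq A) (w : nat -> A).

Lemma undirected_equiv_sym u v : undirected_equiv u v -> undirected_equiv v u.
Proof. by case=> ->; [left | right; rewrite revK]. Qed.

Lemma undirected_equiv_trans v u X :
  undirected_equiv u v -> undirected_equiv v X -> undirected_equiv u X.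
Proof.
by case=> -> [] ->; rewrite ?revK; [left | right | right | left].
Qed.

Lemma size_block w i n : size (block w i n) = n.
Proof. exact: size_mkseq. Qed.

Lemma nth_block x0 w i n j : j < n -> nth x0 (block w i n) j = w (i + j).
Proof. exact: nth_mkseq. Qed.

Lemma block_cat w i m n : block w i (m + n) = block w i m ++ block w (i + m) n.
Proof.
rewrite /block /mkseq iotaD map_cat add0n; congr (_ ++ _).
rewrite -{1}[m]addn0 iotaDl -map_comp.
by apply: eq_map => j /=; rewrite addnA.
Qed.

Lemma drop_block w i n m : m <= n -> drop m (block w i n) = block w (i + m) (n - m).
Proof. by move=> lemn; rewrite -{1}(subnKC lemn) block_cat drop_size_cat ?size_block. Qed.

Lemma take_block w i n m : m <= n -> take m (block w i n) = block w i m.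
Proof. by move=> lemn; rewrite -(subnKC lemn) block_cat take_size_cat ?size_block. Qed.

Lemma subblock w i n m p :
  m + p <= n -> take p (drop m (block w i n)) = block w (i + m) p.
Proof. by move=> le_n; rewrite drop_block ?take_block //; lia. Qed.

Lemma flatten_blocks w i p k :
  flatten (mkseq (fun a => block w (i + a * p) p) k) = block w i (k * p).
Proof.
elim: k i => [|k IHk] i //=.
rewrite mulSn block_cat -IHk /mkseq /= mul0n addn0; congr (_ ++ flatten _).
by rewrite -[1]addn0 iotaDl -map_comp; apply: eq_map => a /=; rewrite mulSn addnA.
Qed.

Lemma nth_flatten_block w i p (Xs : seq (seq A)) a :
    (forall b, b < size Xs -> size (nth [::] Xs b) = p) ->
    flatten Xs = block w i (size (flatten Xs)) -> a < size Xs ->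
  nth [::] Xs a = block w (i + a * p) p.
Proof.
elim: Xs i a => [|X Xs IHXs] i a //= sizeXs eqXs lt_a.
have sizeX : size X = p := sizeXs 0 isT.
rewrite size_cat sizeX block_cat in eqXs.
have eqX := congr1 (take p) eqXs.
rewrite !take_size_cat ?size_block // in eqX.
have {}eqXs := congr1 (drop p) eqXs.
rewrite !drop_size_cat ?size_block // in eqXs.
case: a lt_a => [|a] lt_a /=; first by rewrite mul0n addn0.
rewrite mulSn addnA; apply: IHXs => // b lt_b.
exact: (sizeXs b.+1).
Qed.

(** Reversal preserves length, so all images of the single variable have one common length [p] and
    lie at positions [i + a * p]. *)
Lemma encounters_powerP (V : Type) (x : V) w k :
  0 < k ->
  encounters w (nseq k x) <->
  exists i p, 0 < p /\ has_undirected_power w k i p.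
Proof.
move=> k_gt0; split.
  case=> Xs [sizeXs neXs eqvXs [i eqXs]]; move: sizeXs neXs eqvXs.
  rewrite size_nseq => sizeXs neXs eqvXs.
  have onthE a : a < k -> onth (nseq k x) a = Some x.
    by move=> lt_a; rewrite onthE (nth_map x) ?size_nseq // nth_nseq lt_a.
  have {}eqvXs a b : a < k -> b < k ->
      undirected_equiv (nth [::] Xs a) (nth [::] Xs b).
    by move=> lt_a lt_b; apply: eqvXs; rewrite ?onthE.
  exists i, (size (nth [::] Xs 0)).
  split; first by have := neXs 0 k_gt0; case: (nth _ _ _).
  have XsE a : a < k ->
      nth [::] Xs a = block w (i + a * size (nth [::] Xs 0)) (size (nth [::] Xs 0)).
    move=> lt_a; apply: nth_flatten_block; rewrite ?sizeXs // => b lt_b.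
    by case: (eqvXs 0 b k_gt0 lt_b) => ->; rewrite ?size_rev.
  move=> a lt_a; rewrite -XsE // -{1}[i]addn0 -(mul0n (size (nth [::] Xs 0))).
  by rewrite -XsE //; apply: eqvXs.
case=> i [p [p_gt0 pow]].
exists (mkseq (fun a => block w (i + a * p) p) k); rewrite size_mkseq size_nseq.
split=> //.
- by move=> a lt_a; rewrite nth_mkseq // => /(congr1 size); rewrite size_block /=; lia.
- move=> a b lt_a lt_b _; rewrite !nth_mkseq //.
  by apply: undirected_equiv_trans (pow b lt_b); apply/undirected_equiv_sym/pow.
- by exists i; rewrite flatten_blocks size_block.
Qed.

Lemma has_undirected_power_le w k l i p :
  l <= k -> has_undirected_power w k i p -> has_undirected_power w l i p.
Proof. by move=> le_lk pow a lt_a; apply: pow; apply: leq_trans le_lk. Qed.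

End Blocks.

Lemma map_block (A B : Type) (f : A -> B) (w : nat -> A) i n :
  map f (block w i n) = block (f \o w) i n.
Proof. by rewrite /block /mkseq -map_comp. Qed.

Lemma has_undirected_power_comp (A B : Type) (f : A -> B) (w : nat -> A) k i p :
  has_undirected_power w k i p -> has_undirected_power (f \o w) k i p.
Proof.
by move=> pow a /pow; rewrite -!map_block => -[] ->; [left | right; rewrite map_rev].
Qed.

Lemma has_undirected_power_inj (A B : Type) (f : A -> B) (w : nat -> A) k i p :
  injective f ->
  has_undirected_power (f \o w) k i p -> has_undirected_power w k i p.
Proof.
move=> inj_f pow a /pow; rewrite /undirected_equiv -!map_block -map_rev.
by case=> /(inj_map inj_f); [left | right].
Qed.

(** * Exhaustive checks on finite words *)

Fixpoint words (T : Type) (A : seq T) (n : nat) : seq (seq T) :=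
  if n is m.+1 then [seq x :: u | x <- A, u <- words A m] else [:: [::]].

Lemma mem_words (T : eqType) (A : seq T) (u : seq T) :
  all [in A] u -> u \in words A (size u).
Proof.
elim: u => [|x u IHu] //= /andP[Ax Au].
by apply: (allpairs_f (fun x u => x :: u)); rewrite // IHu.
Qed.

Definition undirected_power_at (T : eqType) (u : seq T) (k i p : nat) : bool :=
  let X := take p (drop i u) in
  all (fun a => take p (drop (i + a * p) u) \in [:: X; rev X]) (iota 0 k).

Lemma undirected_power_atP (T : eqType) (w : nat -> T) n m k i p :
    0 < k -> i + k * p <= n ->
  reflect (has_undirected_power w k (m + i) p)
          (undirected_power_at (block w m n) k i p).
Proof.
move=> k_gt0 le_n.
have subE a : a < k -> take p (drop (i + a * p) (block w m n)) =
    block w (m + i + a * p) p.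
  by move=> lt_a; rewrite subblock ?addnA //; nia.
have sub0 : take p (drop i (block w m n)) = block w (m + i) p.
  by have := subE 0 k_gt0; rewrite mul0n !addn0.
apply: (iffP allP) => pow a.
  move=> lt_a; have := pow a; rewrite mem_iota /= subE // sub0 !inE.
  by move/(_ lt_a)/orP=> -[] /eqP ->; [left | right].
rewrite mem_iota /= => lt_a; rewrite subE // sub0 !inE.
by case: (pow a lt_a) => ->; rewrite eqxx ?orbT.
Qed.

Lemma binary_word_has_undirected_cube (w : nat -> bool) :
  exists i p, 0 < p /\ has_undirected_power w 3 i p.
Proof.
(* The bound [11 - 3 * p] keeps [i + 3 * p <= 10], so each candidate cube lies inside the prefix of
   length 10. *)
have /allP/(_ (block w 0 10)) : all (fun u =>
    has (fun p => has (fun i => undirected_power_at u 3 i p) (iota 0 (11 - 3 * p)))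
      [:: 1; 2; 3]) (words [:: false; true] 10).
  by vm_compute.
case/(_ _)/hasP.
  by apply: mem_words; apply/allP=> -[].
move=> p p123 /hasP[i]; rewrite mem_iota => i_lt.
have p_gt0 : 0 < p by move: p123; rewrite !inE; lia.
move/undirected_power_atP=> pow; exists i, p; split=> //; apply: pow => //.
by lia.
Qed.

(** * Square-free words and the Thue-Morse word *)

Definition square_at (T : Type) (v : nat -> T) (i p : nat) : Prop :=
  forall j, j < p -> v (i + j) = v (i + p + j).

Definition square_free (T : Type) (v : nat -> T) : Prop :=
  forall i p, 0 < p -> ~ square_at v i p.

Lemma square_free_avoids_square (T : Type) (v : nat -> T) i p :
  square_free v -> 0 < p -> ~ has_undirected_power v 2 i p.
Proof.
move=> sqf p_gt0 /(_ 1 isT); rewrite mul1n.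
case=> /(congr1 (fun u => nth (v 0) u)) eqX.
  apply: (sqf i p p_gt0) => j lt_j.
  by rewrite -!(nth_block (v 0) _ _ lt_j) eqX.
(* Reversed case: the last letter of the first block equals the first letter of the second, a square
   of period 1. *)
apply: (sqf (i + p.-1) 1 isT) => -[] // _; rewrite addn0.
have := congr1 (fun f => f 0) eqX.
rewrite nth_rev ?size_block // !nth_block ?subn1 ?prednK // => <-.
by congr v; lia.
Qed.

(** Parity of the sum of the [d] lowest binary digits of [n]. The argument [d] serves as fuel;
    [d = n] is enough to reach every digit. *)
Fixpoint low_digits_parity (d n : nat) : bool :=
  if d is d'.+1 then odd n (+) low_digits_parity d' n./2 else false.

Definition thue_morse (n : nat) : bool := low_digits_parity n n.

Lemma low_digits_parity0 d : low_digits_parity d 0 = false.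
Proof. by elim: d. Qed.

Lemma low_digits_parity_stable d e n :
  n <= d -> n <= e -> low_digits_parity d n = low_digits_parity e n.
Proof.
elim: d e n => [|d IHd] e [|n] le_nd le_ne; rewrite ?low_digits_parity0 //.
case: e le_ne => [|e] // le_ne; rewrite [LHS]/= [RHS]/=; congr (_ (+) _).
by apply: IHd; lia.
Qed.

Lemma thue_morseE n : thue_morse n = odd n (+) thue_morse n./2.
Proof.
case: n => [|n] //; rewrite /thue_morse [LHS]/=; congr (_ (+) _).
by apply: low_digits_parity_stable => /=; lia.
Qed.

Lemma thue_morse_double n : thue_morse n.*2 = thue_morse n.
Proof. by rewrite thue_morseE odd_double doubleK. Qed.

Lemma thue_morse_doubleS n : thue_morse n.*2.+1 = ~~ thue_morse n.
Proof. by rewrite thue_morseE /= odd_double uphalf_double. Qed.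

Lemma thue_morse_even_neq n : ~~ odd n -> thue_morse n.+1 = ~~ thue_morse n.
Proof.
move=> /even_halfK <-; by rewrite thue_morse_doubleS thue_morse_double.
Qed.

(** Strong induction on the period. An odd period forces the letters to alternate, which contradicts
    equality at distance [p]; an even period yields an overlap of half the period. *)
Lemma thue_morse_overlap_free i p : 0 < p ->
  ~ (forall j, j <= p -> thue_morse (i + j) = thue_morse (i + p + j)).
Proof.
elim/ltn_ind: p i => p IHp i p_gt0 ovl.
have period n : i <= n <= i + p -> thue_morse n = thue_morse (n + p).
  move=> n_bnd; have := ovl (n - i).
  have -> : i + (n - i) = n by lia.
  have -> : i + p + (n - i) = n + p by lia.
  by apply; lia.
have [odd_p|even_p] := boolP (odd p).
  (* Letters at [n] and [n.+1] differ when [n] is even. An odd [n] becomes even after a shift by the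
     odd period, forwards in the first half of the range and backwards in the second. *)
  have alt n : i <= n < i + p.*2 -> thue_morse n.+1 = ~~ thue_morse n.
    move=> n_bnd; have [odd_n|] := boolP (odd n); last exact: thue_morse_even_neq.
    have [lt_n|le_n] := ltnP n (i + p).
      rewrite (period n.+1) ?(period n) ?addSn; try lia.
      by apply: thue_morse_even_neq; lia.
    have := period (n - p); have := period (n - p).+1.
    rewrite addSn subnK; last lia.
    move=> <-; last lia.
    move=> <-; last lia.
    by apply: thue_morse_even_neq; lia.
  have iterate m : m <= p -> thue_morse (i + m) = odd m (+) thue_morse i.
    elim: m => [|m IHm] le_m; first by rewrite addn0.
    by rewrite addnS alt ?IHm ?addNb //; lia.
  have := iterate p (leqnn p); rewrite odd_p -period ?leqnn ?leq_addr //.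
  by case: (thue_morse i).
(* The positions of the parity of [i] carry a copy of the Thue-Morse word, complemented when [i] is
   odd. *)
apply: (IHp p./2 _ i./2); try by move: (even_halfK even_p) p_gt0; lia.
move=> j le_j; have := period (i + j.*2).
have [odd_i|even_i] := boolP (odd i).
  have -> : i + j.*2 + p = (i./2 + p./2 + j).*2.+1 by lia.
  have -> : i + j.*2 = (i./2 + j).*2.+1 by lia.
  by rewrite !thue_morse_doubleS => eq_tm; apply/negb_inj/eq_tm; lia.
have -> : i + j.*2 + p = (i./2 + p./2 + j).*2 by lia.
have -> : i + j.*2 = (i./2 + j).*2 by lia.
by rewrite !thue_morse_double; apply; lia.
Qed.

(* One plus the difference of consecutive letters of the Thue-Morse word. *)
Definition ternary_thue_morse (n : nat) : nat :=
  thue_morse n.+1 + ~~ thue_morse n.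

Lemma ternary_thue_morse_lt3 n : ternary_thue_morse n < 3.
Proof. by rewrite /ternary_thue_morse; case: thue_morse; case: thue_morse. Qed.

(* Telescoping over a square shows that the values of [thue_morse] at
   [i], [i + p], [i + 2p] form an arithmetic progression in [{0, 1}], which is
   thus constant. *)
Lemma ternary_thue_morse_square_free : square_free ternary_thue_morse.
Proof.
move=> i p p_gt0 sq.
have shift j : j <= p -> thue_morse (i + j) + thue_morse (i + p) =
    thue_morse (i + p + j) + thue_morse i :> nat.
  elim: j => [|j IHj] le_j; first by rewrite !addn0 addnC.
  have := sq j le_j; have := IHj (ltnW le_j); rewrite /ternary_thue_morse !addnS.
  lia.
have eq_tm : thue_morse i = thue_morse (i + p).
  have := shift p (leqnn p).
  by do 3!case: thue_morse.
(* Once [thue_morse i = thue_morse (i + p)], these terms cancel in [shift], which leaves an overlap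
   of period [p]. *)
apply: (thue_morse_overlap_free p_gt0) => j le_j.
by apply: (can_inj oddb); have := shift j le_j; rewrite eq_tm; lia.
Qed.

(** * The binary coding of a ternary square-free word *)

Definition coding (v : nat -> nat) (n : nat) : bool := v (n %/ 4) < n %% 4.

Section Coding.

Variable v : nat -> nat.
Hypothesis v_lt3 : forall n, v n < 3.
Hypothesis v_sqf : square_free v.

Lemma codingE q r : r < 4 -> coding v (4 * q + r) = (v q < r).
Proof. by move=> lt_r; rewrite /coding; congr (v _ < _); lia. Qed.

(** For letters below 3, these threshold tests give nondecreasing words that start with [false] and
    end with [true]. *)
Definition code (x : nat) : seq bool := [seq x < r | r <- iota 0 4].

Lemma flatten_code q n :
  flatten (map code (block v q n)) = block (coding v) (4 * q) (n * 4).
Proof.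
rewrite -flatten_blocks map_block; congr flatten; apply: eq_map => a.
rewrite /code /block /mkseq [LHS]/comp; apply/eq_in_map => r.
by rewrite mem_iota => lt_r; rewrite [a * 4]mulnC -mulnDr codingE.
Qed.

Definition no_short_repetition (s : seq bool) : bool :=
  (take 8 s != rev (take 8 s)) &&
  all (fun p => ~~ undirected_power_at s 4 0 p) [:: 1; 2; 3].

(** A window of 12 letters meets at most four code words, so it suffices to test the ternary words
    of length 4 without equal neighbours. Length 12 holds four blocks of length up to 3. *)
Lemma coding_no_short_repetition i : no_short_repetition (block (coding v) i 12).
Proof.
have -> : block (coding v) i 12 =
    take 12 (drop (i %% 4) (flatten (map code (block v (i %/ 4) 4)))).
  by rewrite flatten_code subblock; [congr block; lia | lia].
have /allP/(_ (block v (i %/ 4) 4)) : all (fun u =>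
    sorted (fun x y => x != y) u ==>
    all (fun r => no_short_repetition (take 12 (drop r (flatten (map code u)))))
      (iota 0 4)) (words (iota 0 3) 4).
  by vm_compute.
move/(_ _)/implyP/(_ _)/allP; apply; last by rewrite mem_iota; lia.
- apply: (mem_words (u := block v (i %/ 4) 4)); apply/allP => _ /mapP[j _ ->].
  by rewrite mem_iota v_lt3.
- have neq_v n : v n != v n.+1.
    apply/eqP => eq_v; apply: (v_sqf (i := n) (p := 1)) => // -[] // _.
    by rewrite !addn0 addn1.
  by rewrite /= !addnS !neq_v.
Qed.

(** Inside a code word the letters never decrease, so a descent marks a boundary. *)
Lemma coding_descent n : coding v n -> ~~ coding v n.+1 -> n %% 4 = 3.
Proof.
move=> vn; apply: contraNeq => n_mod; move: vn; rewrite /coding.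
have -> : n.+1 %/ 4 = n %/ 4 by lia.
lia.
Qed.

Lemma coding_block_end n : n %% 4 = 3 -> coding v n.
Proof. by rewrite /coding => ->. Qed.

Lemma coding_block_start n : n %% 4 = 0 -> ~~ coding v n.
Proof. by rewrite /coding => ->. Qed.

Lemma coding_avoids_fourth_power i p :
  0 < p -> ~ has_undirected_power (coding v) 4 i p.
Proof.
move=> p_gt0 pow.
have [le_p3|lt_3p] := leqP p 3.
  have /andP[_ /allP/(_ p)] := coding_no_short_repetition i.
  have p123 : p \in [:: 1; 2; 3] by rewrite !inE; lia.
  move/(_ p123)/negP; apply; apply/undirected_power_atP => //; first by lia.
  by rewrite addn0.
(* If a block were the reversal of its predecessor, the two would form a palindrome centred at their
   border [c]. As [p >= 4], its middle 8 letters, starting at [c - 4], would be a forbidden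
   palindrome. *)
have next a : a < 3 ->
    block (coding v) (i + a.+1 * p) p = block (coding v) (i + a * p) p.
  move=> lt_a3; have := undirected_equiv_trans
    (undirected_equiv_sym (pow a (ltnW lt_a3))) (pow a.+1 lt_a3).
  set c := i + a.+1 * p; case=> // eq_rev.
  have mirror k : k < p -> coding v (c + k) = coding v (c - k.+1).
    move=> lt_k; have := congr1 (fun u => nth false u k) eq_rev.
    rewrite nth_rev size_block // !nth_block //; last by lia.
    by move=> ->; congr (coding v _); rewrite /c; lia.
  have /andP[/eqP[]] := coding_no_short_repetition (c - 4).
  rewrite take_block //; apply: (eq_from_nth (x0 := false)).
    by rewrite size_rev.
  move=> j; rewrite size_block => lt_j8.
  rewrite nth_rev size_block // !nth_block //; last by lia.
  have c_ge4 : 4 <= c by rewrite /c; lia.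
  have [lt_j4|le_4j] := ltnP j 4.
    have -> : c - 4 + j = c - (3 - j).+1 by lia.
    by rewrite -mirror; [congr (coding v _); lia | lia].
  have -> : c - 4 + j = c + (j - 4) by lia.
  by rewrite mirror; [congr (coding v _); lia | lia].
have period n : i <= n < i + 3 * p -> coding v n = coding v (n + p).
  move=> n_bnd; have lt_a3 : (n - i) %/ p < 3 by rewrite ltn_divLR //; lia.
  have lt_k : (n - i) %% p < p by rewrite ltn_mod.
  have := congr1 (fun u => nth false u ((n - i) %% p)) (next _ lt_a3).
  rewrite !nth_block // mulSn => eq_k; have n_eq := divn_eq (n - i) p.
  have -> : n = i + (n - i) %/ p * p + (n - i) %% p by lia.
  by rewrite -eq_k; congr (coding v _); lia.
pose q := p %/ 4; pose b := (i %/ 4).+1.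
have p_mod : p = 4 * q.
  (* The code word containing position [i] ends at [d]; the period carries the descent after [d] to
     [d + p], which must also end a code word. *)
  pose d := 4 * (i %/ 4) + 3.
  have desc : (d + p) %% 4 = 3.
    apply: coding_descent; rewrite -?addSn -period /d; try lia.
      by apply: coding_block_end; lia.
    by apply: coding_block_start; lia.
  by move: desc; rewrite /d /q; lia.
apply: (v_sqf (i := b) (p := q)) => [|j lt_j]; first by lia.
(* Code word [b] is the first to start after [i], so the period applies to it and the next [q - 1]
   ones. The thresholds 1 and 2 already determine a letter below 3. *)
have eq_lt r : r < 4 -> (v (b + j) < r) = (v (b + q + j) < r).
  move=> lt_r; rewrite -!codingE // period; last by rewrite /b; lia.
  by congr (coding v _); lia.
by have := eq_lt 1 isT; have := eq_lt 2 isT; have := v_lt3 (b + j);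
  have := v_lt3 (b + q + j); lia.
Qed.

End Coding.

(** * Avoidability over one, two and three letters, and the index *)

Section Index.

Variables (V : Type) (x : V).

Lemma avoidable_nseqP (k n : nat) : 0 < k -> 0 < n ->
  avoidable_over (nseq k x) n <->
  exists w : nat -> 'I_n, forall i p, 0 < p -> ~ has_undirected_power w k i p.
Proof.
move=> k_gt0 n_gt0; split.
  case=> _ [w av]; exists w => i p p_gt0 pow; apply: av.
  by apply/encounters_powerP => //; exists i, p.
case=> w av; split=> //; exists w.
by move/(encounters_powerP x w k_gt0) => [i [p [p_gt0 /(av i p p_gt0)]]].
Qed.

Lemma not_avoidable_over1 k : 0 < k -> ~ avoidable_over (nseq k x) 1.
Proof.
move=> k_gt0 /(avoidable_nseqP k_gt0 (ltn0Sn _))[w /(_ 0 1 isT)]; apply=> a _.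
(* Over one letter, blocks of length 1 at position 0 already form a power. *)
by left; congr [:: _]; rewrite !ord1.
Qed.

Lemma not_avoidable_over2 k : 0 < k <= 3 -> ~ avoidable_over (nseq k x) 2.
Proof.
case/andP=> k_gt0 le_k3 /(avoidable_nseqP k_gt0 (ltn0Sn _))[w av].
have [i [p [p_gt0 pow]]] :=
  binary_word_has_undirected_cube ((fun y : 'I_2 => y == ord0) \o w).
apply: (av i p p_gt0); apply: has_undirected_power_le le_k3 _.
apply: has_undirected_power_inj pow => y z.
by case: y z => [[|[|//]] ?] [[|[|//]] ?] // _; apply: val_inj.
Qed.

Lemma avoidable_over2 k : 4 <= k -> avoidable_over (nseq k x) 2.
Proof.
move=> le_4k; apply/avoidable_nseqP => //; first exact: leq_trans le_4k.
exists (fun n => inord (coding ternary_thue_morse n)) => i p p_gt0.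
move/(has_undirected_power_le le_4k).
move/(has_undirected_power_comp (fun y : 'I_2 => y == 1 :> nat)).
have -> : (fun y : 'I_2 => y == 1 :> nat) \o
    (fun n => inord (coding ternary_thue_morse n)) = coding ternary_thue_morse.
  by apply/funext => n /=; rewrite inordK; case: coding.
apply: coding_avoids_fourth_power => //; first exact: ternary_thue_morse_lt3.
exact: ternary_thue_morse_square_free.
Qed.

Lemma avoidable_over3 k : 2 <= k -> avoidable_over (nseq k x) 3.
Proof.
move=> le_2k; apply/avoidable_nseqP => //; first exact: leq_trans le_2k.
exists (fun n => inord (ternary_thue_morse n)) => i p p_gt0.
move/(has_undirected_power_le le_2k)/(has_undirected_power_comp (@nat_of_ord 3)).
have -> : @nat_of_ord 3 \o (fun n => inord (ternary_thue_morse n)) =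
    ternary_thue_morse.
  by apply/funext => n /=; rewrite inordK ?ternary_thue_morse_lt3.
exact/square_free_avoids_square/p_gt0/ternary_thue_morse_square_free.
Qed.

End Index.

Lemma undirected_indexE (V : Type) (p : seq V) n :
  avoidable_over p n -> (forall m, m < n -> ~ avoidable_over p m) ->
  undirected_index p = Some n.
Proof.
move=> av_n least; rewrite /undirected_index; case: pselect => [av|[]]; last first.
  by exists n; apply/asboolP.
congr Some; case: ex_minnP => m /asboolP av_m min_m.
apply/eqP; rewrite eqn_leq min_m; last exact/asboolP.
by rewrite leqNgt; apply/negP => /least.
Qed.

Theorem theorem7 (V : Type) (x : V) (k : nat) :
  (k = 2 \/ k = 3 -> undirected_index (nseq k x) = Some 3) /\
  (4 <= k -> undirected_index (nseq k x) = Some 2).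
Proof.
split=> [k23|le_4k].
  apply: undirected_indexE; first by apply: avoidable_over3; lia.
  case=> [_ []//|[_|[_|//]]].
    by apply: not_avoidable_over1; lia.
  by apply: not_avoidable_over2; lia.
apply: undirected_indexE; first exact: avoidable_over2.
case=> [_ []//|[_|//]].
by apply: not_avoidable_over1; lia.
Qed.
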